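(* Let $\mathbb{D}=\{z\in\mathbb{C} : |z|<1\}$. For every holomorphic mapping $f:\mathbb{D}\to\mathbb{D}$ and all $z,w\in\mathbb{D}$, $$ j_{\mathbb{D}}(f(z),f(w))\le 2\, j_{\mathbb{D}}(z,w). $$
   Context: For a proper subdomain $G\subset\mathbb{R}^n$ (with $\mathbb{C}$ identified with $\mathbb{R}^2$) the distance ratio metric $j_G$ is defined for $x,y\in G$ by $$ j_G(x,y)=\log\left(1+\frac{|x-y|}{\min\{d(x,\partial G),d(y,\partial G)\}}\right), $$ where $d(x,\partial G)$ denotes the Euclidean distance from $x$ to the boundary $\partial G$. In particular, for the open unit disk $\mathbb{D}$, $d(z,\partial\mathbb{D})=1-|z|$, so $j_{\mathbb{D}}(z,w)=\log\left(1+\frac{|z-w|}{1-\max\{|z|,|w|\}}\right)$. *)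

(* Defs.v *)
From Stdlib Require Import Reals.
From Coquelicot Require Export Coquelicot.

Open Scope R_scope.

Definition unit_disk (z : C) : Prop := Cmod z < 1.

Definition boundary (G : C -> Prop) (x : C) : Prop :=
  forall P : C -> Prop, locally x P ->
    (exists y : C, P y /\ G y) /\ (exists y : C, P y /\ ~ G y).

(* The infimum of |z - y| over y in E.  It is a real number as soon as E is
   nonempty, as is the boundary of a proper subdomain of the plane; the
   projection [real] gives the junk value 0 when E is empty. *)
Definition dist_to (z : C) (E : C -> Prop) : R :=
  real (Glb_Rbar (fun r => exists y : C, E y /\ r = Cmod (z - y))).

(* The distance ratio metric of G, meaningful for z and w in G. *)
Definition distance_ratio (G : C -> Prop) (z w : C) : R :=
  ln (1 + Cmod (z - w) / Rmin (dist_to z (boundary G)) (dist_to w (boundary G))).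

(* Complex differentiability: the scalars are C, not R.  Maps are total
   functions on C, and for open U only their values on U matter here. *)
Definition holomorphic_on (U : C -> Prop) (f : C -> C) : Prop :=
  forall z : C, U z -> @ex_derive C_AbsRing C_NormedModule f z.

(* Main.v *)
(** The Schwarz-Pick lemma says that [f] does not increase the pseudohyperbolic
    distance [|z - w| / |1 - conj z * w|].  The theorem follows because, if that
    distance is [rho] for [z, w], then
    [exp (j (f z) (f w)) <= (1 + rho) / (1 - rho) <= exp (2 * j z w)].

    Schwarz-Pick comes from the maximum principle for the quotient of two Blaschke
    factors, which is only known to be continuous at [z].  Such an exceptional
    point is harmless, because the mean value property holds for circles centred
    at it: in logarithmic polar coordinates the integral over a circle is
    independent of the radius by Green's theorem, and the centre enters only
    through the limit of small radii.  As nothing is known about the continuity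
    of [f'], Green's theorem is proved by Goursat's subdivision of rectangles. *)

Require Import Defs.
From Stdlib Require Import Reals Lra Psatz ClassicalEpsilon.
From Coquelicot Require Import Coquelicot.

Open Scope R_scope.

(** * Subdivision of intervals and rectangles *)

(** Every left end [a m] is at most every right end [a n + w / 2 ^ n], so the supremum of the left
    ends lies in all the intervals. *)
Lemma nested_halving (a : nat -> R) (w : R) :
  0 <= w ->
  (forall n, a n <= a (S n) /\ a (S n) + w / 2 ^ S n <= a n + w / 2 ^ n) ->
  exists x, forall n, a n <= x <= a n + w / 2 ^ n.
Proof.
  intros Hw Ha.
  assert (Hpos : forall n, 0 <= w / 2 ^ n).
  { intros n; apply Rdiv_le_0_compat; [exact Hw | apply pow_lt; lra]. }
  assert (Hmon : forall n k, a n <= a (n + k)%nat /\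
                   a (n + k)%nat + w / 2 ^ (n + k) <= a n + w / 2 ^ n).
  { intros n k; induction k as [|k IH].
    - rewrite Nat.add_0_r; lra.
    - rewrite Nat.add_succ_r; destruct (Ha (n + k)%nat); lra. }
  assert (Hle : forall n m, a m <= a n + w / 2 ^ n).
  { intros n m; destruct (Nat.le_ge_cases n m) as [H|H].
    - destruct (Hmon n (m - n)%nat) as [_ H2].
      replace (n + (m - n))%nat with m in H2 by lia.
      specialize (Hpos m); lra.
    - destruct (Hmon m (n - m)%nat) as [H1 _].
      replace (m + (n - m))%nat with n in H1 by lia.
      specialize (Hpos n); lra. }
  destruct (completeness (fun r => exists n, r = a n)) as [x [Hub Hlub]].
  - exists (a O + w / 2 ^ 0); intros r [n ->]; apply Hle.
  - exists (a O); exists O; reflexivity.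
  - exists x; intros n; split.
    + apply Hub; exists n; reflexivity.
    + apply Hlub; intros r [m ->]; apply Hle.
Qed.

(* A two-dimensional Cousin lemma: [T x y w h] is about the rectangle
   [x, x + w] * [y, y + h]. *)
Lemma rectangle_induction (T : R -> R -> R -> R -> Prop) (a c w h : R) :
  0 <= w -> 0 <= h ->
  (forall a c w h, 0 <= w -> 0 <= h ->
     T a c (w / 2) (h / 2) -> T (a + w / 2) c (w / 2) (h / 2) ->
     T a (c + h / 2) (w / 2) (h / 2) -> T (a + w / 2) (c + h / 2) (w / 2) (h / 2) ->
     T a c w h) ->
  (forall x y, a <= x <= a + w -> c <= y <= c + h ->
     exists d, 0 < d /\ forall a' c' w' h',
       w' < d -> h' < d -> a' <= x <= a' + w' -> c' <= y <= c' + h' ->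
       T a' c' w' h') ->
  T a c w h.
Proof.
  intros Hw Hh Hmerge Hloc.
  apply NNPP; intros HT.
  assert (Hpos : forall u n, 0 <= u -> 0 <= u / 2 ^ n).
  { intros u n Hu; apply Rdiv_le_0_compat; [exact Hu | apply pow_lt; lra]. }
  assert (Hhalf : forall u n, u / 2 ^ S n = u / 2 ^ n / 2).
  { intros u n; simpl; field; apply pow_nonzero; lra. }
  (* The premise [~ T] stands inside the existential, so that choice yields a total function on
     pairs, which can be iterated. *)
  assert (Hstep : forall (np : nat * (R * R)), exists q : R * R,
    let n := fst np in let p := snd np in
    ~ T (fst p) (snd p) (w / 2 ^ n) (h / 2 ^ n) ->
    ~ T (fst q) (snd q) (w / 2 ^ S n) (h / 2 ^ S n) /\
    (fst q = fst p \/ fst q = fst p + w / 2 ^ S n) /\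
    (snd q = snd p \/ snd q = snd p + h / 2 ^ S n)).
  { intros [n [x y]]; cbn zeta; simpl fst; simpl snd; rewrite !Hhalf.
    apply NNPP; intros Hno; apply Hno.
    (* This witness is a placeholder: its premise is refuted, since by [Hno] all four quarters
       satisfy [T] and [Hmerge] applies. *)
    exists (x, y); intros HnT; exfalso; apply HnT.
    assert (Hq : forall x' y', (x' = x \/ x' = x + w / 2 ^ n / 2) ->
      (y' = y \/ y' = y + h / 2 ^ n / 2) -> T x' y' (w / 2 ^ n / 2) (h / 2 ^ n / 2)).
    { intros x' y' Hx Hy; apply NNPP; intros HnT'; apply Hno.
      exists (x', y'); intros _; simpl; auto. }
    apply Hmerge; auto. }
  pose (next := fun np => proj1_sig (constructive_indefinite_description _ (Hstep np))).
  pose (pos := nat_rect (fun _ => (R * R)%type) (a, c) (fun n p => next (n, p))).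
  assert (Hnext : forall n, ~ T (fst (pos n)) (snd (pos n)) (w / 2 ^ n) (h / 2 ^ n) ->
    ~ T (fst (pos (S n))) (snd (pos (S n))) (w / 2 ^ S n) (h / 2 ^ S n) /\
    (fst (pos (S n)) = fst (pos n) \/ fst (pos (S n)) = fst (pos n) + w / 2 ^ S n) /\
    (snd (pos (S n)) = snd (pos n) \/ snd (pos (S n)) = snd (pos n) + h / 2 ^ S n)).
  { intros n.
    exact (proj2_sig (constructive_indefinite_description _ (Hstep (n, pos n)))). }
  assert (HnT : forall n, ~ T (fst (pos n)) (snd (pos n)) (w / 2 ^ n) (h / 2 ^ n)).
  { intros n; induction n as [|n IH].
    - simpl; rewrite !Rdiv_1_r; exact HT.
    - apply Hnext; exact IH. }
  destruct (nested_halving (fun n => fst (pos n)) w Hw) as [x Hx].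
  { intros n; destruct (Hnext n (HnT n)) as [_ [Hf _]].
    specialize (Hpos w n Hw); rewrite Hhalf in *; destruct Hf as [-> | ->]; lra. }
  destruct (nested_halving (fun n => snd (pos n)) h Hh) as [y Hy].
  { intros n; destruct (Hnext n (HnT n)) as [_ [_ Hf]].
    specialize (Hpos h n Hh); rewrite Hhalf in *; destruct Hf as [-> | ->]; lra. }
  pose proof (Hx O) as Hx0; pose proof (Hy O) as Hy0; simpl in Hx0, Hy0.
  rewrite Rdiv_1_r in Hx0, Hy0.
  destruct (Hloc x y Hx0 Hy0) as [d [Hd HTd]].
  (* The [+ 1] keeps the bound meaningful for a rectangle reduced to a point. *)
  destruct (pow_lt_1_zero (/ 2)) with (y := d / (w + h + 1)) as [N HN].
  { rewrite Rabs_pos_eq; lra. }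
  { apply Rdiv_lt_0_compat; lra. }
  specialize (HN N (le_n N)).
  assert (HN2 : 0 < (/ 2) ^ N) by (apply pow_lt; lra).
  rewrite Rabs_pos_eq in HN by lra.
  apply Rlt_div_r in HN; [|lra].
  apply (HnT N), HTd; [| | apply Hx | apply Hy];
    unfold Rdiv; rewrite <- pow_inv; nra.
Qed.

(** * Circulation around rectangles and Green's theorem *)

Lemma continuous_slice_x (P : R -> R -> R) (x y : R) :
  continuity_2d_pt P x y -> continuous (fun t => P t y) x.
Proof.
  intros H; apply filterlim_locally; intros eps.
  destruct (H eps) as [d Hd]; exists d; intros t Ht.
  apply Hd; [exact Ht | rewrite Rminus_diag, Rabs_R0; apply cond_pos].
Qed.

Lemma continuous_slice_y (P : R -> R -> R) (x y : R) :
  continuity_2d_pt P x y -> continuous (fun t => P x t) y.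
Proof.
  intros H; apply filterlim_locally; intros eps.
  destruct (H eps) as [d Hd]; exists d; intros t Ht.
  apply Hd; [rewrite Rminus_diag, Rabs_R0; apply cond_pos | exact Ht].
Qed.

(** The counterclockwise integral of [P dx + Q dy] along the boundary of the rectangle, with
    opposite sides paired under one integral. *)
Definition circulation (P Q : R -> R -> R) (a c w h : R) : R :=
  RInt (fun x => P x c - P x (c + h)) a (a + w) +
  RInt (fun y => Q (a + w) y - Q a y) c (c + h).

Lemma ex_RInt_slice_x (P : R -> R -> R) (a w c d : R) :
  0 <= w ->
  (forall x, a <= x <= a + w -> continuity_2d_pt P x c /\ continuity_2d_pt P x d) ->
  ex_RInt (fun x => P x c - P x d) a (a + w).
Proof.
  intros Hw H; apply (ex_RInt_continuous (V := R_CompleteNormedModule)).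
  intros x; rewrite Rmin_left, Rmax_right by lra; intros Hx.
  apply (continuous_minus (V := R_NormedModule));
    apply continuous_slice_x; apply H; exact Hx.
Qed.

Lemma ex_RInt_slice_y (Q : R -> R -> R) (c h a b : R) :
  0 <= h ->
  (forall y, c <= y <= c + h -> continuity_2d_pt Q a y /\ continuity_2d_pt Q b y) ->
  ex_RInt (fun y => Q b y - Q a y) c (c + h).
Proof.
  intros Hw H; apply (ex_RInt_continuous (V := R_CompleteNormedModule)).
  intros x; rewrite Rmin_left, Rmax_right by lra; intros Hx.
  apply (continuous_minus (V := R_NormedModule));
    apply continuous_slice_y; apply H; exact Hx.
Qed.

(** Opposite sides are compared through the middle line [g], and each integral is cut at its
    midpoint; the four terms are those that occur in the circulations of the quarters. *)
Lemma RInt_split_diff (f g k : R -> R) (a w : R) :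
  0 <= w ->
  ex_RInt (fun x => f x - g x) a (a + w) ->
  ex_RInt (fun x => g x - k x) a (a + w) ->
  RInt (fun x => f x - k x) a (a + w) =
  (RInt (fun x => f x - g x) a (a + w / 2) +
   RInt (fun x => f x - g x) (a + w / 2) (a + w / 2 + w / 2)) +
  (RInt (fun x => g x - k x) a (a + w / 2) +
   RInt (fun x => g x - k x) (a + w / 2) (a + w / 2 + w / 2)).
Proof.
  intros Hw Hf Hg.
  replace (a + w / 2 + w / 2) with (a + w) by lra.
  assert (Hm : a <= a + w / 2 <= a + w) by lra.
  pose proof (RInt_Chasles (fun x => f x - g x) a (a + w / 2) (a + w)
    (ex_RInt_Chasles_1 _ _ _ _ Hm Hf) (ex_RInt_Chasles_2 _ _ _ _ Hm Hf)) as E1.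
  pose proof (RInt_Chasles (fun x => g x - k x) a (a + w / 2) (a + w)
    (ex_RInt_Chasles_1 _ _ _ _ Hm Hg) (ex_RInt_Chasles_2 _ _ _ _ Hm Hg)) as E2.
  unfold plus in E1, E2; simpl in E1, E2; rewrite E1, E2.
  pose proof (RInt_plus (V := R_CompleteNormedModule) _ _ a (a + w) Hf Hg) as E3.
  unfold plus in E3; simpl in E3; rewrite <- E3.
  apply RInt_ext; intros x _; change (f x - k x = f x - g x + (g x - k x)); ring.
Qed.

(** Each inner edge is traversed twice, in opposite directions. *)
Lemma circulation_quarter (P Q : R -> R -> R) (a c w h : R) :
  0 <= w -> 0 <= h ->
  (forall x y, a <= x <= a + w -> c <= y <= c + h ->
     continuity_2d_pt P x y /\ continuity_2d_pt Q x y) ->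
  circulation P Q a c w h =
  circulation P Q a c (w / 2) (h / 2) +
  circulation P Q (a + w / 2) c (w / 2) (h / 2) +
  circulation P Q a (c + h / 2) (w / 2) (h / 2) +
  circulation P Q (a + w / 2) (c + h / 2) (w / 2) (h / 2).
Proof.
  intros Hw Hh H; unfold circulation.
  rewrite (RInt_split_diff (fun x => P x c) (fun x => P x (c + h / 2))
             (fun x => P x (c + h)) a w Hw);
    try (apply ex_RInt_slice_x; [lra | intros; split; apply H; lra]).
  rewrite (RInt_split_diff (Q (a + w)) (Q (a + w / 2)) (Q a) c h Hh);
    try (apply ex_RInt_slice_y; [lra | intros; split; apply H; lra]).
  replace (a + w / 2 + w / 2) with (a + w) by lra.
  replace (c + h / 2 + h / 2) with (c + h) by lra.
  ring.
Qed.

Lemma RInt_near_const (f : R -> R) (a w k e : R) :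
  0 <= w -> ex_RInt f a (a + w) ->
  (forall x, a <= x <= a + w -> Rabs (f x - k) <= e) ->
  Rabs (RInt f a (a + w) - w * k) <= w * e.
Proof.
  intros Hw Hf H.
  assert (Hk : ex_RInt (fun _ : R => k) a (a + w)) by apply ex_RInt_const.
  replace (RInt f a (a + w) - w * k) with (RInt (fun x => f x - k) a (a + w)).
  - replace (w * e) with ((a + w - a) * e) by ring.
    apply abs_RInt_le_const; [lra | apply (ex_RInt_minus (V := R_NormedModule)); auto | exact H].
  - pose proof (RInt_minus (V := R_CompleteNormedModule) _ _ a (a + w) Hf Hk) as E.
    pose proof (RInt_const (V := R_CompleteNormedModule) a (a + w) k) as E2.
    rewrite E2 in E; replace (a + w - a) with w in E by ring; exact E.
Qed.

(** The common derivative [l] makes the affine part of the form closed, so only the remainder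
    contributes. The bound is in [w ^ 2 + h ^ 2], which controls elongated rectangles too and is
    additive under quartering. *)
Lemma circulation_small (P Q : R -> R -> R) (x y px l qy : R) (eps : posreal) :
  differentiable_pt_lim P x y px l -> differentiable_pt_lim Q x y l qy ->
  exists d, 0 < d /\ forall a c w h,
    w < d -> h < d -> a <= x <= a + w -> c <= y <= c + h ->
    (forall x y, a <= x <= a + w -> c <= y <= c + h ->
       continuity_2d_pt P x y /\ continuity_2d_pt Q x y) ->
    Rabs (circulation P Q a c w h) <= eps * (w ^ 2 + h ^ 2).
Proof.
  intros HP HQ.
  assert (He : 0 < eps / 4) by (pose proof (cond_pos eps); lra).
  destruct (HP (mkposreal _ He)) as [d1 H1].
  destruct (HQ (mkposreal _ He)) as [d2 H2].
  exists (Rmin d1 d2); split; [apply Rmin_pos; apply cond_pos|].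
  intros a c w h Hw Hh Hx Hy Hc; simpl in H1, H2.
  assert (Hd1 := Rmin_l d1 d2); assert (Hd2 := Rmin_r d1 d2).
  set (D := Rmax w h).
  assert (HwD : w <= D) by apply Rmax_l.
  assert (HhD : h <= D) by apply Rmax_r.
  assert (HD : D ^ 2 <= w ^ 2 + h ^ 2).
  { unfold D, Rmax; destruct (Rle_dec w h); nra. }
  assert (Hin : forall u v, a <= u <= a + w -> c <= v <= c + h ->
     Rabs (u - x) <= D /\ Rabs (v - y) <= D /\ Rabs (u - x) < d1 /\
     Rabs (v - y) < d1 /\ Rabs (u - x) < d2 /\ Rabs (v - y) < d2).
  { intros u v Hu Hv.
    assert (Rabs (u - x) <= w) by (apply Rabs_le; lra).
    assert (Rabs (v - y) <= h) by (apply Rabs_le; lra).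
    repeat split; lra. }
  assert (EP : forall u v, a <= u <= a + w -> c <= v <= c + h ->
     Rabs (P u v - P x y - (px * (u - x) + l * (v - y))) <= eps / 4 * D).
  { intros u v Hu Hv; destruct (Hin u v Hu Hv) as (A1 & A2 & A3 & A4 & _).
    eapply Rle_trans; [apply H1; assumption|].
    apply Rmult_le_compat_l; [lra | apply Rmax_lub; assumption]. }
  assert (EQ : forall u v, a <= u <= a + w -> c <= v <= c + h ->
     Rabs (Q u v - Q x y - (l * (u - x) + qy * (v - y))) <= eps / 4 * D).
  { intros u v Hu Hv; destruct (Hin u v Hu Hv) as (A1 & A2 & _ & _ & A3 & A4).
    eapply Rle_trans; [apply H2; assumption|].
    apply Rmult_le_compat_l; [lra | apply Rmax_lub; assumption]. }
  unfold circulation.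
  (* The affine parts contribute [- l * h * w] and [l * w * h], which cancel. Each integrand is a
     difference of two values with error [eps / 4 * D]. *)
  assert (B1 := RInt_near_const (fun u => P u c - P u (c + h)) a w (- l * h)
                  (eps / 2 * D)).
  assert (B2 := RInt_near_const (fun v => Q (a + w) v - Q a v) c h (l * w)
                  (eps / 2 * D)).
  apply Rabs_le_between in B1; [apply Rabs_le_between in B2|..].
  - apply Rabs_le.
    assert (w * (eps / 2 * D) + h * (eps / 2 * D) <= eps * (w ^ 2 + h ^ 2)).
    { apply Rle_trans with (eps * D ^ 2); [|apply Rmult_le_compat_l; lra].
      replace (w * (eps / 2 * D) + h * (eps / 2 * D)) with (eps * (D * (w / 2 + h / 2))) by field.
      apply Rmult_le_compat_l; [lra|]; simpl; rewrite Rmult_1_r.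
      apply Rmult_le_compat_l; lra. }
    lra.
  - lra.
  - apply ex_RInt_slice_y; [lra | intros; split; apply Hc; lra].
  - intros v Hv.
    assert (E1 : a <= a + w <= a + w) by lra.
    assert (E2 : a <= a <= a + w) by lra.
    assert (F1 := EQ _ _ E1 Hv); assert (F2 := EQ _ _ E2 Hv).
    apply Rabs_le_between in F1; apply Rabs_le_between in F2; apply Rabs_le; lra.
  - lra.
  - apply ex_RInt_slice_x; [lra | intros; split; apply Hc; lra].
  - intros u Hu.
    assert (E1 : c <= c <= c + h) by lra.
    assert (E2 : c <= c + h <= c + h) by lra.
    assert (F1 := EP _ _ Hu E1); assert (F2 := EP _ _ Hu E2).
    apply Rabs_le_between in F1; apply Rabs_le_between in F2; apply Rabs_le; lra.
Qed.

(* Goursat's version of Green's theorem: the partial derivatives need not be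
   continuous. *)
Lemma closed_form_circulation (P Q : R -> R -> R) (a c w h : R) :
  0 <= w -> 0 <= h ->
  (forall x y, a <= x <= a + w -> c <= y <= c + h ->
     exists px l qy, differentiable_pt_lim P x y px l /\
                     differentiable_pt_lim Q x y l qy) ->
  circulation P Q a c w h = 0.
Proof.
  intros Hw Hh H.
  assert (Hc : forall x y, a <= x <= a + w -> c <= y <= c + h ->
     continuity_2d_pt P x y /\ continuity_2d_pt Q x y).
  { intros x y Hx Hy; destruct (H x y Hx Hy) as (px & l & qy & H1 & H2).
    split; apply differentiable_continuity_pt; [exists px, l | exists l, qy]; assumption. }
  assert (Hsmall : forall eps : posreal,
    Rabs (circulation P Q a c w h) <= eps * (w ^ 2 + h ^ 2)).
  { intros eps.
    apply (rectangle_induction (fun a' c' w' h' =>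
       a <= a' /\ a' + w' <= a + w -> c <= c' /\ c' + h' <= c + h ->
       Rabs (circulation P Q a' c' w' h') <= eps * (w' ^ 2 + h' ^ 2)) a c w h Hw Hh);
      [ | | lra | lra ].
    - intros a' c' w' h' Hw' Hh' T1 T2 T3 T4 Ha Hb.
      rewrite circulation_quarter by (try assumption; intros; apply Hc; lra).
      specialize (T1 ltac:(lra) ltac:(lra)); specialize (T2 ltac:(lra) ltac:(lra)).
      specialize (T3 ltac:(lra) ltac:(lra)); specialize (T4 ltac:(lra) ltac:(lra)).
      eapply Rle_trans; [apply Rabs_triang|].
      eapply Rle_trans; [apply Rplus_le_compat_r, Rabs_triang|].
      eapply Rle_trans; [apply Rplus_le_compat_r, Rplus_le_compat_r, Rabs_triang|].
      lra.
    - intros x y Hx Hy; destruct (H x y Hx Hy) as (px & l & qy & H1 & H2).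
      destruct (circulation_small P Q x y px l qy eps H1 H2) as [d [Hd Hs]].
      exists d; split; [exact Hd|].
      intros a' c' w' h' A B C D E F; apply Hs; auto.
      intros; apply Hc; lra. }
  destruct (Req_dec (circulation P Q a c w h) 0) as [E|E]; [exact E | exfalso].
  apply Rabs_pos_lt in E.
  assert (He : 0 < Rabs (circulation P Q a c w h) / (2 * (w ^ 2 + h ^ 2 + 1))).
  { apply Rdiv_lt_0_compat; nra. }
  specialize (Hsmall (mkposreal _ He)); cbn [pos] in Hsmall.
  set (m := Rabs _) in *; set (k := w ^ 2 + h ^ 2) in *.
  assert (0 <= k) by (apply Rplus_le_le_0_compat; apply pow2_ge_0).
  assert (m / (2 * (k + 1)) * k <= m / 2); [|lra].
  replace (m / (2 * (k + 1)) * k) with (m / 2 * (k / (k + 1))) by (field; lra).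
  assert (k / (k + 1) <= 1) by (apply Rle_div_l; lra).
  rewrite <- (Rmult_1_r (m / 2)) at 2; apply Rmult_le_compat_l; lra.
Qed.

Lemma C_eta (z : C) : (Re z, Im z) = z.
Proof. symmetry; apply surjective_pairing. Qed.

(** * Complex differentiability *)

Definition ccont (f : C -> C) (z : C) : Prop :=
  continuity_2d_pt (fun x y => Re (f (x, y))) (Re z) (Im z) /\
  continuity_2d_pt (fun x y => Im (f (x, y))) (Re z) (Im z).

(* Complex differentiability in Caratheodory's form. *)
Definition cdiff (f : C -> C) (z : C) : Prop :=
  exists q : C -> C, ccont q z /\
    locally_2d (fun x y => f (x, y) = f z + ((x, y) - z) * q (x, y))%C (Re z) (Im z).

Lemma ccont_const (k z : C) : ccont (fun _ => k) z.
Proof. split; apply continuity_2d_pt_const. Qed.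

Lemma ccont_id (z : C) : ccont (fun y => y) z.
Proof. split; [apply continuity_2d_pt_id1 | apply continuity_2d_pt_id2]. Qed.

Lemma ccont_plus (f g : C -> C) (z : C) :
  ccont f z -> ccont g z -> ccont (fun y => f y + g y)%C z.
Proof. intros [] []; split; apply continuity_2d_pt_plus; assumption. Qed.

Lemma ccont_mult (f g : C -> C) (z : C) :
  ccont f z -> ccont g z -> ccont (fun y => f y * g y)%C z.
Proof.
  intros [] []; split; [apply continuity_2d_pt_minus | apply continuity_2d_pt_plus];
    apply continuity_2d_pt_mult; assumption.
Qed.

Lemma continuity_2d_pt_sqr (f : R -> R -> R) (x y : R) :
  continuity_2d_pt f x y -> continuity_2d_pt (fun u v => f u v ^ 2) x y.
Proof.
  intros H; apply continuity_2d_pt_mult; [exact H|].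
  apply continuity_2d_pt_mult; [exact H | apply continuity_2d_pt_const].
Qed.

Lemma ccont_Cmod_sqr (f : C -> C) (z : C) :
  ccont f z -> continuity_2d_pt (fun x y => Cmod (f (x, y)) ^ 2) (Re z) (Im z).
Proof.
  intros [H1 H2].
  apply continuity_2d_pt_ext with (fun x y => Re (f (x, y)) ^ 2 + Im (f (x, y)) ^ 2).
  - intros; symmetry; apply Cmod2_alt.
  - apply continuity_2d_pt_plus; apply continuity_2d_pt_sqr; assumption.
Qed.

Lemma Cmod_sqr_neq_0 (z : C) : z <> 0%C -> Cmod z ^ 2 <> 0.
Proof. intros H; apply pow_nonzero; intros E; apply H, Cmod_eq_0, E. Qed.

Lemma ccont_neq_0 (f : C -> C) (z : C) :
  ccont f z -> f z <> 0%C -> locally_2d (fun x y => f (x, y) <> 0%C) (Re z) (Im z).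
Proof.
  intros H Hz.
  assert (L := continuity_2d_pt_neq_0 _ _ _ (ccont_Cmod_sqr f z H)).
  destruct L as [d Hd]; [rewrite C_eta; apply Cmod_sqr_neq_0, Hz|].
  exists d; intros u v Hu Hv E; apply (Hd u v Hu Hv); rewrite E, Cmod_0; ring.
Qed.

Lemma ccont_inv (f : C -> C) (z : C) :
  ccont f z -> f z <> 0%C -> ccont (fun y => / f y)%C z.
Proof.
  intros [H1 H2] Hz.
  assert (Hi : continuity_2d_pt (fun x y => / (fst (f (x, y)) ^ 2 + snd (f (x, y)) ^ 2))
                 (Re z) (Im z)).
  { apply continuity_2d_pt_inv.
    - apply continuity_2d_pt_plus; apply continuity_2d_pt_sqr; assumption.
    - rewrite C_eta.
      pose proof (Cmod_sqr_neq_0 _ Hz) as E; rewrite Cmod2_alt in E; exact E. }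
  split; apply continuity_2d_pt_mult; auto.
  apply continuity_2d_pt_opp; assumption.
Qed.

(** The Cauchy-Riemann equations, with [l + i m = q z]: the remainder of the linear approximation is
    [(y - z) * (q y - q z)], and [q] is continuous at [z]. *)
Lemma cdiff_differentiable (f : C -> C) (z : C) :
  cdiff f z -> exists l m,
    differentiable_pt_lim (fun x y => Re (f (x, y))) (Re z) (Im z) l (- m) /\
    differentiable_pt_lim (fun x y => Im (f (x, y))) (Re z) (Im z) m l.
Proof.
  intros [q [[Hq1 Hq2] Hf]].
  exists (Re (q z)), (Im (q z)).
  assert (Hq : forall eps : posreal, locally_2d (fun u v =>
    f (u, v) = (f z + ((u, v) - z) * q (u, v))%C /\
    Rabs (Re (q (u, v)) - Re (q z)) < eps / 2 /\
    Rabs (Im (q (u, v)) - Im (q z)) < eps / 2) (Re z) (Im z)).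
  { intros eps.
    assert (He : 0 < eps / 2) by (pose proof (cond_pos eps); lra).
    specialize (Hq1 (mkposreal _ He)); specialize (Hq2 (mkposreal _ He)).
    cbv beta in Hq1, Hq2; rewrite C_eta in Hq1, Hq2.
    repeat apply locally_2d_and; assumption. }
  assert (Hb : forall (eps : posreal) u v a b,
    Rabs a < eps / 2 -> Rabs b < eps / 2 ->
    Rabs (u * a + v * b) <= eps * Rmax (Rabs u) (Rabs v)).
  { intros eps u v a b Ha Hb.
    eapply Rle_trans; [apply Rabs_triang|]; rewrite !Rabs_mult.
    pose proof (Rmax_l (Rabs u) (Rabs v)); pose proof (Rmax_r (Rabs u) (Rabs v)).
    pose proof (Rabs_pos u); pose proof (Rabs_pos v).
    pose proof (Rabs_pos a); pose proof (Rabs_pos b).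
    assert (Rabs u * Rabs a <= Rmax (Rabs u) (Rabs v) * (eps / 2)) by
      (apply Rmult_le_compat; lra).
    assert (Rabs v * Rabs b <= Rmax (Rabs u) (Rabs v) * (eps / 2)) by
      (apply Rmult_le_compat; lra).
    lra. }
  split; intros eps; destruct (Hq eps) as [d Hd]; exists d; intros u v Hu Hv;
    destruct (Hd u v Hu Hv) as (E & Ha & Hc); rewrite E, C_eta.
  - eapply Rle_trans; [|apply (Hb eps _ _ _ (- (Im (q (u, v)) - Im (q z))) Ha)].
    + right; f_equal; unfold Re, Im; simpl; ring.
    + rewrite Rabs_Ropp; exact Hc.
  - eapply Rle_trans; [|apply (Hb eps _ _ _ _ Hc Ha)].
    right; f_equal; unfold Re, Im; simpl; ring.
Qed.

Lemma cdiff_ccont (f : C -> C) (z : C) : cdiff f z -> ccont f z.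
Proof.
  intros H; destruct (cdiff_differentiable f z H) as (l & m & H1 & H2).
  split; apply differentiable_continuity_pt; eexists; eexists; eassumption.
Qed.

Lemma cdiff_const (k z : C) : cdiff (fun _ => k) z.
Proof.
  exists (fun _ => 0%C); split; [apply ccont_const|].
  apply locally_2d_forall; intros; ring.
Qed.

Lemma cdiff_id (z : C) : cdiff (fun y => y) z.
Proof.
  exists (fun _ => 1%C); split; [apply ccont_const|].
  apply locally_2d_forall; intros u v; generalize ((u, v) : C); intros y; ring.
Qed.

Lemma cdiff_plus (f g : C -> C) (z : C) :
  cdiff f z -> cdiff g z -> cdiff (fun y => f y + g y)%C z.
Proof.
  intros [q [Hq Hf]] [r [Hr Hg]].
  exists (fun y => q y + r y)%C; split; [apply ccont_plus; assumption|].
  destruct (locally_2d_and _ _ _ _ Hf Hg) as [d Hd]; exists d; intros u v Hu Hv.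
  destruct (Hd u v Hu Hv) as [-> ->]; ring.
Qed.

Lemma cdiff_mult (f g : C -> C) (z : C) :
  cdiff f z -> cdiff g z -> cdiff (fun y => f y * g y)%C z.
Proof.
  intros Df Dg; pose proof (cdiff_ccont _ _ Dg) as Cg.
  destruct Df as [q [Hq Hf]]; destruct Dg as [r [Hr Hg]].
  (* From [f y * g y - f z * g z = (f y - f z) * g y + f z * (g y - g z)]. *)
  exists (fun y => q y * g y + f z * r y)%C; split.
  - apply ccont_plus; apply ccont_mult; auto; apply ccont_const.
  - destruct (locally_2d_and _ _ _ _ Hf Hg) as [d Hd]; exists d; intros u v Hu Hv.
    destruct (Hd u v Hu Hv) as [-> E]; rewrite E; ring.
Qed.

Lemma cdiff_inv (f : C -> C) (z : C) :
  cdiff f z -> f z <> 0%C -> cdiff (fun y => / f y)%C z.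
Proof.
  intros Df Hz; pose proof (cdiff_ccont _ _ Df) as Cf.
  destruct Df as [q [Hq Hf]].
  exists (fun y => - / f z * (q y * / f y))%C; split.
  - apply ccont_mult; [apply ccont_const|].
    apply ccont_mult; [exact Hq | apply ccont_inv; assumption].
  - destruct (locally_2d_and _ _ _ _ Hf (ccont_neq_0 f z Cf Hz)) as [d Hd].
    exists d; intros u v Hu Hv; destruct (Hd u v Hu Hv) as [E N].
    assert (E' : (((u, v) - z) * q (u, v) = f (u, v) - f z)%C) by (rewrite E; ring).
    transitivity (/ f z + - / f z * (((u, v) - z) * q (u, v)) * / f (u, v))%C; [|ring].
    rewrite E'; field; auto.
Qed.

Lemma cdiff_ext_loc (f g : C -> C) (z : C) :
  locally_2d (fun x y => f (x, y) = g (x, y)) (Re z) (Im z) -> cdiff f z -> cdiff g z.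
Proof.
  intros L [q [Hq Hf]]; exists q; split; [exact Hq|].
  pose proof (locally_2d_singleton _ _ _ L) as Ez.
  cbv beta in Ez; rewrite C_eta in Ez.
  destruct (locally_2d_and _ _ _ _ Hf L) as [d Hd]; exists d; intros u v Hu Hv.
  destruct (Hd u v Hu Hv) as [E1 E2]; rewrite <- E2, <- Ez; exact E1.
Qed.

Lemma Cminus_neq_0 (a b : C) : a <> b -> (a - b)%C <> 0%C.
Proof.
  intros H E; apply H; replace a with (a - b + b)%C by ring.
  rewrite E; ring.
Qed.

Lemma ccont_of_Cmod (f : C -> C) (z : C) :
  (forall eps, 0 < eps -> exists d, 0 < d /\
     forall y, Cmod (y - z) < d -> Cmod (f y - f z) < eps) ->
  ccont f z.
Proof.
  intros H.
  assert (Hc : forall eps : posreal, exists d : posreal, forall u v,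
    Rabs (u - Re z) < d -> Rabs (v - Im z) < d -> Cmod (f (u, v) - f z) < eps).
  { intros eps; destruct (H eps (cond_pos eps)) as [d [Hd Hy]].
    assert (Hd2 : 0 < d / sqrt 2).
    { apply Rdiv_lt_0_compat; [exact Hd | apply Rlt_sqrt2_0]. }
    exists (mkposreal _ Hd2); simpl; intros u v Hu Hv; apply Hy.
    eapply Rle_lt_trans; [apply Cmod_2Rmax|].
    rewrite Rmult_comm; apply Rlt_div_r; [apply Rlt_sqrt2_0|].
    apply Rmax_lub_lt; assumption. }
  split; intros eps; destruct (Hc eps) as [d Hd]; exists d; intros u v Hu Hv;
    eapply Rle_lt_trans; [|exact (Hd u v Hu Hv)| |exact (Hd u v Hu Hv)];
    rewrite C_eta; (eapply Rle_trans; [|apply Rmax_Cmod]).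
  - apply Rmax_l.
  - apply Rmax_r.
Qed.

(** The difference quotient, completed at [z] by the derivative. The identity holds for all [y], so
    [q] can serve as a quotient on the whole disk. *)
Lemma ex_derive_slope (f : C -> C) (z : C) :
  @ex_derive C_AbsRing C_NormedModule f z ->
  exists q : C -> C, ccont q z /\ forall y, f y = (f z + (y - z) * q y)%C.
Proof.
  intros H.
  assert (Hl : exists l : C, forall eps, 0 < eps -> exists d, 0 < d /\ forall y,
    Cmod (y - z) < d -> Cmod (f y - f z - (y - z) * l) <= eps * Cmod (y - z)).
  { destruct H as [l [_ Hl]]; exists l; intros eps He.
    (* [fun P H => H] proves that the filter of neighbourhoods of [z] converges to [z]. *)
    destruct (Hl z (fun P H => H) (mkposreal _ He)) as [d Hd].
    exists d; split; [apply cond_pos|].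
    intros y Hy; exact (Hd y Hy). }
  destruct Hl as [l Hd].
  pose (q := fun y => if excluded_middle_informative (y = z) then l
                      else ((f y - f z) / (y - z))%C).
  assert (Hqz : q z = l).
  { unfold q; destruct (excluded_middle_informative (z = z)) as [_|N];
      [reflexivity | now elim N]. }
  assert (Hq : forall y, y <> z -> q y = ((f y - f z) / (y - z))%C).
  { intros y N; unfold q; destruct (excluded_middle_informative (y = z)) as [E|_];
      [now elim N | reflexivity]. }
  exists q; split.
  - apply ccont_of_Cmod; intros eps He.
    destruct (Hd (eps / 2)) as [d [Hd0 Hd1]]; [lra|].
    exists d; split; [exact Hd0|]; intros y Hy; rewrite Hqz.
    destruct (excluded_middle_informative (y = z)) as [->|N].
    + unfold Cminus; rewrite Hqz, Cplus_opp_r, Cmod_0; exact He.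
    + rewrite Hq by exact N; apply Cminus_neq_0 in N.
      replace ((f y - f z) / (y - z) - l)%C
        with ((f y - f z - (y - z) * l) / (y - z))%C by (field; exact N).
      rewrite Cmod_div by exact N.
      apply Rle_lt_trans with (eps / 2); [|lra].
      apply Rle_div_l; [apply Cmod_gt_0, N | apply Hd1, Hy].
  - intros y; destruct (excluded_middle_informative (y = z)) as [->|N].
    + ring.
    + rewrite Hq by exact N; field; apply Cminus_neq_0, N.
Qed.

(** * Mean values and the maximum principle *)

Definition circle_pt (p : C) (r t : R) : C := (Re p + r * cos t, Im p + r * sin t).

Lemma Cmod_circle_pt (p : C) (r t : R) : 0 <= r -> Cmod (circle_pt p r t - p) = r.
Proof.
  intros Hr; unfold Cmod; simpl.
  replace (_ + _) with (r ^ 2 * ((sin t)² + (cos t)²)) by (unfold Re, Im, Rsqr; ring).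
  rewrite sin2_cos2, Rmult_1_r; apply sqrt_pow2, Hr.
Qed.

(* In the coordinates [p + exp (s + i t)] the form [g dz / (z - p)] becomes
   [g (ds + i dt)], whose imaginary part is closed. *)
Lemma circle_integral_exp (g : C -> C) (p : C) (s0 s1 : R) :
  s0 <= s1 ->
  (forall z, 0 < Cmod (z - p) <= exp s1 -> cdiff g z) ->
  RInt (fun t => Re (g (circle_pt p (exp s1) t)) - Re (g (circle_pt p (exp s0) t)))
    0 (2 * PI) = 0.
Proof.
  intros Hs Hg.
  pose proof PI_RGT_0 as Hpi.
  assert (E : circulation (fun s t => Im (g (circle_pt p (exp s) t)))
                (fun s t => Re (g (circle_pt p (exp s) t))) s0 0 (s1 - s0) (2 * PI) = 0).
  { apply closed_form_circulation; [lra | lra |].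
    intros s t Hst _.
    destruct (cdiff_differentiable g (circle_pt p (exp s) t)) as (l & m & H1 & H2).
    { apply Hg; rewrite Cmod_circle_pt by (left; apply exp_pos).
      split; [apply exp_pos|].
      destruct (Req_dec s s1) as [->|N]; [lra | left; apply exp_increasing; lra]. }
    assert (De : forall F F' : R -> R, (forall x, derivable_pt_lim F x (F' x)) ->
      forall k x y, differentiable_pt_lim (fun s t => k + exp s * F t) x y
        (exp x * F y) (exp x * F' y)).
    { intros F F' HF k x y; apply filterdiff_differentiable_pt_lim.
      apply filterdiff_ext_lin with
        (fun u : R * R => plus (scal (fst u) (exp x * F y)) (scal (snd u) (exp x * F' y)));
        [|reflexivity].
      apply (is_derive_filterdiff (fun s t => k + exp s * F t) x y
               (fun s t => exp s * F t) (exp x * F' y)).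
      - apply filter_forall; intros u; auto_derive; [trivial | ring].
      - auto_derive; [exists (F' y); apply is_derive_Reals, HF|].
        replace (Derive (fun t : R => F t) y) with (F' y); [ring|].
        symmetry; apply is_derive_unique, is_derive_Reals, HF.
      - apply (continuous_mult (K := R_AbsRing) (fun u : R * R => exp (fst u))
                 (fun u : R * R => F (snd u))).
        + apply continuous_comp; [apply continuous_fst | apply continuous_exp].
        + apply continuous_comp; [apply continuous_snd|].
          apply (ex_derive_continuous (V := R_NormedModule)).
          exists (F' y); apply is_derive_Reals, HF. }
    assert (Dx := De cos (fun t => - sin t) derivable_pt_lim_cos (Re p) s t).
    assert (Dy := De sin cos derivable_pt_lim_sin (Im p) s t).
    pose proof (differentiable_pt_lim_comp _ _ _ _ _ _ _ _ _ _ _ H1 Dx Dy) as C1.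
    pose proof (differentiable_pt_lim_comp _ _ _ _ _ _ _ _ _ _ _ H2 Dx Dy) as C2.
    eexists; eexists; eexists; split; [exact C2|].
    (* Closedness: by Cauchy-Riemann the [s]-derivative of the real part equals the [t]-derivative
       of the imaginary part. *)
    match type of C1 with differentiable_pt_lim _ _ _ ?a ?b =>
      replace a with (m * (exp s * - sin t) + l * (exp s * cos t)) in C1 by ring end.
    exact C1. }
  unfold circulation in E.
  replace (s0 + (s1 - s0)) with s1 in E by ring.
  rewrite Rplus_0_l in E.
  (* The angles [0] and [2 * PI] give the same point, so these two sides cancel. *)
  rewrite (RInt_ext _ (fun _ => 0)) in E.
  - rewrite RInt_const in E.
    unfold scal in E; simpl in E; unfold mult in E; simpl in E.
    rewrite Rmult_0_r, Rplus_0_l in E; exact E.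
  - intros x _; unfold circle_pt.
    rewrite cos_2PI, sin_2PI, cos_0, sin_0; apply Rminus_diag.
Qed.

Lemma ex_RInt_circle (g : C -> C) (p : C) (r : R) :
  (forall t, ccont g (circle_pt p r t)) ->
  ex_RInt (fun t => Re (g (circle_pt p r t))) 0 (2 * PI).
Proof.
  intros H; apply (ex_RInt_continuous (V := R_CompleteNormedModule)); intros t _.
  apply (continuous_comp_2 (U := R_UniformSpace) (V := R_UniformSpace) (W := R_UniformSpace)
    (fun t => Re p + r * cos t) (fun t => Im p + r * sin t) (fun x y => Re (g (x, y)))).
  - apply (ex_derive_continuous (V := R_NormedModule)); auto_derive; trivial.
  - apply (ex_derive_continuous (V := R_NormedModule)); auto_derive; trivial.
  - destruct (H t) as [H1 _]; apply continuity_2d_pt_filterlim in H1; exact H1.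
Qed.

(** The integral keeps its value when the radius shrinks to [s], and for small [s] continuity at [p]
    puts it near [2 * PI * Re (g p)]. *)
Lemma circle_mean (g : C -> C) (p : C) (r : R) :
  0 < r -> ccont g p -> (forall z, 0 < Cmod (z - p) <= r -> cdiff g z) ->
  RInt (fun t => Re (g (circle_pt p r t))) 0 (2 * PI) = 2 * PI * Re (g p).
Proof.
  intros Hr Hp Hg; pose proof PI_RGT_0 as Hpi.
  assert (Hex : forall s, 0 < s <= r ->
    ex_RInt (fun t => Re (g (circle_pt p s t))) 0 (2 * PI)).
  { intros s Hs; apply ex_RInt_circle; intros t.
    apply cdiff_ccont, Hg; rewrite Cmod_circle_pt; lra. }
  set (I := RInt _ _ _ : R).
  assert (Hsmall : forall eps, 0 < eps -> Rabs (I - 2 * PI * Re (g p)) <= 2 * PI * eps).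
  { intros eps He; destruct Hp as [Hp _]; destruct (Hp (mkposreal _ He)) as [d Hd].
    set (s := Rmin r (d / 2)).
    assert (Hs : 0 < s <= r /\ s < d).
    { pose proof (cond_pos d); unfold s, Rmin; destruct (Rle_dec r (d / 2)); lra. }
    assert (E := circle_integral_exp g p (ln s) (ln r)).
    rewrite !exp_ln in E by lra.
    specialize (E (ln_le s r ltac:(lra) ltac:(lra)) Hg).
    pose proof (RInt_minus (V := R_CompleteNormedModule) _ _ 0 (2 * PI)
      (Hex r ltac:(lra)) (Hex s ltac:(lra))) as E2.
    assert (E3 : 0 = I - RInt (fun t => Re (g (circle_pt p s t))) 0 (2 * PI)).
    { etransitivity; [symmetry; exact E | exact E2]. }
    replace I with (RInt (fun t => Re (g (circle_pt p s t))) 0 (0 + 2 * PI))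
      by (rewrite Rplus_0_l; lra).
    apply RInt_near_const; [lra | rewrite Rplus_0_l; apply Hex; lra |].
    intros t _.
    assert (Ht : Rabs (Re p + s * cos t - Re p) < d /\ Rabs (Im p + s * sin t - Im p) < d).
    { split; apply Rabs_lt_between; pose proof (COS_bound t); pose proof (SIN_bound t); nra. }
    left; pose proof (Hd _ _ (proj1 Ht) (proj2 Ht)) as L; cbv beta in L.
    rewrite C_eta in L; exact L. }
  destruct (Req_dec (I - 2 * PI * Re (g p)) 0) as [E|E]; [lra | exfalso].
  apply Rabs_pos_lt in E.
  set (m := Rabs (I - 2 * PI * Re (g p))) in *.
  assert (He : 0 < m / (4 * PI)) by (apply Rdiv_lt_0_compat; lra).
  specialize (Hsmall _ He).
  replace (2 * PI * (m / (4 * PI))) with (m / 2) in Hsmall by (field; lra).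
  lra.
Qed.

(* [|g|^2 + e |z|^2] is strictly below its circle means; both terms are bounded
   below by their tangents at [p], which are real parts of holomorphic maps. *)
Lemma no_local_max (g : C -> C) (p : C) (r e : R) :
  0 < r -> 0 < e -> ccont g p -> (forall z, 0 < Cmod (z - p) <= r -> cdiff g z) ->
  ~ (forall t, Cmod (g (circle_pt p r t)) ^ 2 + e * Cmod (circle_pt p r t) ^ 2 <=
               Cmod (g p) ^ 2 + e * Cmod p ^ 2).
Proof.
  intros Hr He Hc Hd Hmax; pose proof PI_RGT_0 as Hpi.
  pose (G := fun y => ((2 * Cconj (g p)) * g y + (RtoC (2 * e) * Cconj p) * y)%C).
  assert (HGp : ccont G p).
  { apply ccont_plus; apply ccont_mult; auto using ccont_const, ccont_id. }
  assert (HGd : forall z, 0 < Cmod (z - p) <= r -> cdiff G z).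
  { intros z Hz; apply cdiff_plus; apply cdiff_mult; auto using cdiff_const, cdiff_id. }
  pose proof (circle_mean G p r Hr HGp HGd) as E.
  (* [Re (G y)] equals [|g y|^2 + |g p|^2 - |g y - g p|^2 + e (|y|^2 + |p|^2 - |y - p|^2)]. Dropping
     [|g y - g p|^2] and using [Hmax] leaves [Re (G p) - e * r ^ 2], which contradicts the mean
     value property. *)
  assert (Hle : forall t, Re (G (circle_pt p r t)) <= Re (G p) - e * r ^ 2).
  { intros t; specialize (Hmax t).
    assert (Hy : Cmod (circle_pt p r t - p) ^ 2 = r ^ 2)
      by (rewrite Cmod_circle_pt; [reflexivity | lra]).
    revert Hmax Hy; generalize (circle_pt p r t); intros y Hmax Hy.
    unfold G; rewrite !Cmod2_alt in *.
    destruct (g y) as [a b], (g p) as [a' b'], y as [x1 x2], p as [p1 p2].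
    unfold Re, Im in *; simpl in *.
    pose proof (pow2_ge_0 (a - a')); pose proof (pow2_ge_0 (b - b')).
    rewrite <- Hy; lra. }
  assert (L : RInt (fun t => Re (G (circle_pt p r t))) 0 (2 * PI) <=
              RInt (fun _ => Re (G p) - e * r ^ 2) 0 (2 * PI)).
  { apply RInt_le; [lra | | apply ex_RInt_const | intros; apply Hle].
    apply ex_RInt_circle; intros t; apply cdiff_ccont, HGd.
    rewrite Cmod_circle_pt; lra. }
  rewrite E, RInt_const in L.
  unfold scal in L; simpl in L; unfold mult in L; simpl in L.
  assert (0 < PI * (e * (r * r))) by 
    (apply Rmult_lt_0_compat; [lra |]; do 2 (apply Rmult_lt_0_compat; [lra|]); lra).
  lra.
Qed.

(** Compactness of the closed disk. [Good] is trivial when [v] is to be bounded, and [m < S] when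
    its supremum [S] is to be attained. *)
Lemma disk_bound_of_local (v : R -> R -> R) (r : R) (Good : R -> Prop) :
  0 <= r -> (forall m m', Good m -> Good m' -> Good (Rmax m m')) ->
  (forall x y, x ^ 2 + y ^ 2 <= r ^ 2 ->
     exists m, Good m /\ locally_2d (fun u w => v u w <= m) x y) ->
  exists m, Good m /\ forall x y, x ^ 2 + y ^ 2 <= r ^ 2 -> v x y <= m.
Proof.
  intros Hr Hmax Hloc.
  destruct (rectangle_induction (fun a c w h => exists m, Good m /\
    forall x y, a <= x <= a + w -> c <= y <= c + h -> x ^ 2 + y ^ 2 <= r ^ 2 -> v x y <= m)
    (- r) (- r) (2 * r) (2 * r)) as [m [Hm Hv]]; [lra | lra | | |].
  - intros a c w h Hw Hh (m1 & G1 & H1) (m2 & G2 & H2) (m3 & G3 & H3) (m4 & G4 & H4).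
    exists (Rmax (Rmax m1 m2) (Rmax m3 m4)); split; [auto|].
    intros x y Hx Hy Hxy.
    pose proof (Rmax_l (Rmax m1 m2) (Rmax m3 m4)).
    pose proof (Rmax_r (Rmax m1 m2) (Rmax m3 m4)).
    pose proof (Rmax_l m1 m2); pose proof (Rmax_r m1 m2).
    pose proof (Rmax_l m3 m4); pose proof (Rmax_r m3 m4).
    destruct (Rle_dec x (a + w / 2)), (Rle_dec y (c + h / 2)).
    + pose proof (H1 x y ltac:(lra) ltac:(lra) Hxy); lra.
    + pose proof (H3 x y ltac:(lra) ltac:(lra) Hxy); lra.
    + pose proof (H2 x y ltac:(lra) ltac:(lra) Hxy); lra.
    + pose proof (H4 x y ltac:(lra) ltac:(lra) Hxy); lra.
  - intros x y _ _.
    destruct (Rle_dec (x ^ 2 + y ^ 2) (r ^ 2)) as [Hxy|Hxy].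
    + destruct (Hloc x y Hxy) as [m [Hm [d Hd]]].
      exists d; split; [apply cond_pos|].
      intros a c w h Hw Hh Hx Hy; exists m; split; [exact Hm|].
      intros u z Hu Hz _; apply Hd; apply Rabs_lt_between; lra.
    (* Small rectangles around a point off the disk miss the disk, so any good [m] will do; one is
       taken from the origin. *)
    + assert (Hout : locally_2d (fun u z => r ^ 2 < u ^ 2 + z ^ 2) x y).
      { assert (Hc : continuity_2d_pt (fun u z => u ^ 2 + z ^ 2) x y).
        { apply continuity_2d_pt_plus; apply continuity_2d_pt_sqr;
            [apply continuity_2d_pt_id1 | apply continuity_2d_pt_id2]. }
        assert (He : 0 < x ^ 2 + y ^ 2 - r ^ 2) by lra.
        destruct (Hc (mkposreal _ He)) as [d Hd]; exists d; intros u z Hu Hz.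
        specialize (Hd u z Hu Hz); apply Rabs_lt_between in Hd; cbn [pos] in Hd; lra. }
      destruct Hout as [d Hd].
      destruct (Hloc 0 0) as [m [Hm _]]; [nra|].
      exists d; split; [apply cond_pos|].
      intros a c w h Hw Hh Hx Hy; exists m; split; [exact Hm|].
      intros u z Hu Hz Huz; exfalso.
      assert (r ^ 2 < u ^ 2 + z ^ 2) by (apply Hd; apply Rabs_lt_between; lra); lra.
  - exists m; split; [exact Hm|].
    intros x y Hxy; apply Hv; [nra | nra | exact Hxy].
Qed.

(** If the supremum [S] were not attained, [v] would be locally bounded by numbers below [S], hence
    globally by one such number. *)
Lemma disk_attains_max (v : R -> R -> R) (r : R) :
  0 <= r ->
  (forall x y, x ^ 2 + y ^ 2 <= r ^ 2 -> continuity_2d_pt v x y) ->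
  exists x0 y0, x0 ^ 2 + y0 ^ 2 <= r ^ 2 /\
    forall x y, x ^ 2 + y ^ 2 <= r ^ 2 -> v x y <= v x0 y0.
Proof.
  intros Hr Hc.
  assert (Hup : forall x y e, x ^ 2 + y ^ 2 <= r ^ 2 -> 0 < e ->
    locally_2d (fun u w => v u w <= v x y + e) x y).
  { intros x y e Hxy He; destruct (Hc x y Hxy (mkposreal _ He)) as [d Hd].
    exists d; intros u w Hu Hw; specialize (Hd u w Hu Hw).
    apply Rabs_lt_between in Hd; cbn [pos] in Hd; lra. }
  destruct (disk_bound_of_local v r (fun _ => True) Hr) as [M [_ HM]]; [auto| |].
  { intros x y Hxy; exists (v x y + 1); split; [exact I | apply Hup; [exact Hxy | lra]]. }
  destruct (completeness (fun s => exists x y, x ^ 2 + y ^ 2 <= r ^ 2 /\ s = v x y))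
    as [S [Hub Hlub]].
  - exists M; intros s (x & y & Hxy & ->); apply HM, Hxy.
  - exists (v 0 0), 0, 0; split; [nra | reflexivity].
  - apply NNPP; intros Hno.
    assert (Hlt : forall x y, x ^ 2 + y ^ 2 <= r ^ 2 -> v x y < S).
    { intros x y Hxy; apply Rnot_le_lt; intros HS; apply Hno; exists x, y.
      split; [exact Hxy|]; intros u w Huw.
      apply Rle_trans with S; [apply Hub; exists u, w; auto | exact HS]. }
    destruct (disk_bound_of_local v r (fun m => m < S) Hr) as [m [Hm Hv]].
    + intros m m' H H'; apply Rmax_lub_lt; assumption.
    + intros x y Hxy; specialize (Hlt x y Hxy).
      exists (v x y + (S - v x y) / 2); split; [lra | apply Hup; [exact Hxy | lra]].
    + apply (Rlt_not_le _ _ Hm), Hlub; intros s (x & y & Hxy & ->); apply Hv, Hxy.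
Qed.

Lemma Cmod_le_sqr (z : C) (r : R) : 0 <= r -> (Cmod z <= r <-> Cmod z ^ 2 <= r ^ 2).
Proof. intros Hr; pose proof (Cmod_ge_0 z); split; intros; nra. Qed.

(** A maximum point [p] of [|g|^2 + e |z|^2] cannot be interior, by [no_local_max]; on the boundary
    it contradicts the choice of [e]. *)
Lemma maximum_modulus (g : C -> C) (c : C) (r M : R) :
  0 <= r -> 0 <= M ->
  (forall z, Cmod z <= r -> ccont g z) ->
  (forall z, Cmod z < r -> z <> c -> cdiff g z) ->
  (forall z, Cmod z = r -> Cmod (g z) <= M) ->
  forall z, Cmod z <= r -> Cmod (g z) <= M.
Proof.
  intros Hr HM Hc Hd Hb z0 Hz0; apply Rnot_lt_le; intros Hlt.
  (* Small enough that the extra term, at most [e * r ^ 2] on the disk, does not close the gap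
     between [M ^ 2] and [|g z0|^2]. *)
  pose (e := (Cmod (g z0) ^ 2 - M ^ 2) / (2 * (r ^ 2 + 1))).
  assert (He : 0 < e) by (apply Rdiv_lt_0_compat; nra).
  assert (Her : e * r ^ 2 < Cmod (g z0) ^ 2 - M ^ 2).
  { assert (e * (2 * (r ^ 2 + 1)) = Cmod (g z0) ^ 2 - M ^ 2) by (unfold e; field; nra).
    nra. }
  assert (Hdisk : forall x y, x ^ 2 + y ^ 2 <= r ^ 2 <-> Cmod (x, y) <= r).
  { intros x y; rewrite Cmod_le_sqr by exact Hr; rewrite Cmod2_alt; reflexivity. }
  destruct (disk_attains_max (fun x y => Cmod (g (x, y)) ^ 2 + e * Cmod (x, y) ^ 2) r Hr)
    as (x0 & y0 & Hxy & Hmax).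
  { intros x y Hxy; apply continuity_2d_pt_plus.
    - apply (ccont_Cmod_sqr g (x, y)), Hc, Hdisk, Hxy.
    - apply continuity_2d_pt_mult; [apply continuity_2d_pt_const|].
      apply (ccont_Cmod_sqr (fun y => y) (x, y)), ccont_id. }
  apply Hdisk in Hxy; set (p := (x0, y0) : C) in *.
  assert (Hmax' : forall y, Cmod y <= r ->
    Cmod (g y) ^ 2 + e * Cmod y ^ 2 <= Cmod (g p) ^ 2 + e * Cmod p ^ 2).
  { intros [x y] Hy; apply Hmax, Hdisk, Hy. }
  clear Hmax.
  destruct (Rle_lt_or_eq_dec _ _ Hxy) as [Hp|Hp].
  - assert (Hrho : exists rho, 0 < rho /\ Cmod p + rho < r /\
                     (* The circle is either centred at the exceptional point [c] or leaves it
                        outside. *)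
                     (p = c \/ rho < Cmod (c - p))).
    { destruct (excluded_middle_informative (p = c)) as [E|N].
      - exists ((r - Cmod p) / 2); split; [lra|]; split; [lra | now left].
      - assert (Hpc : 0 < Cmod (c - p)) by (apply Cmod_gt_0, Cminus_neq_0; auto).
        exists (Rmin (r - Cmod p) (Cmod (c - p)) / 2).
        pose proof (Rmin_l (r - Cmod p) (Cmod (c - p))).
        pose proof (Rmin_r (r - Cmod p) (Cmod (c - p))).
        assert (0 < Rmin (r - Cmod p) (Cmod (c - p))) by (apply Rmin_pos; lra).
        split; [lra|]; split; [lra | right; lra]. }
    destruct Hrho as (rho & Hrho & Hin & Hpc).
    assert (Hball : forall z, Cmod (z - p) <= rho -> Cmod z < r).
    { intros z Hz; replace z with (p + (z - p))%C by ring.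
      pose proof (Cmod_triangle p (z - p)); lra. }
    apply (no_local_max g p rho e Hrho He).
    + apply Hc; lra.
    + intros z Hz; apply Hd; [apply Hball; lra|].
      intros ->; destruct Hpc as [E|E]; [|lra].
      rewrite <- E in Hz; unfold Cminus in Hz; rewrite Cplus_opp_r, Cmod_0 in Hz; lra.
    + intros t; apply Hmax'; left; apply Hball; rewrite Cmod_circle_pt; lra.
  - specialize (Hmax' z0 Hz0); specialize (Hb p Hp).
    pose proof (Cmod_ge_0 (g p)); pose proof (Cmod_ge_0 z0).
    rewrite Hp in Hmax'.
    assert (Cmod (g p) ^ 2 <= M ^ 2) by nra.
    assert (0 <= e * Cmod z0 ^ 2) by nra.
    lra.
Qed.

(** * The Schwarz-Pick lemma *)

(** The exact defect in [|a - b| <= |1 - conj a * b|], from which all estimates on Blaschke factors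
    follow. *)
Lemma Cmod_one_minus_conj_mult (a b : C) :
  Cmod (1 - Cconj a * b) ^ 2 = Cmod (a - b) ^ 2 + (1 - Cmod a ^ 2) * (1 - Cmod b ^ 2).
Proof.
  rewrite !Cmod2_alt; destruct a, b; unfold Re, Im; simpl; ring.
Qed.

Lemma Cmod_sub_le_one_minus_conj_mult (a b : C) :
  Cmod a <= 1 -> Cmod b <= 1 -> Cmod (a - b) <= Cmod (1 - Cconj a * b).
Proof.
  intros Ha Hb; apply Cmod_le_sqr; [apply Cmod_ge_0|].
  rewrite Cmod_one_minus_conj_mult.
  pose proof (Cmod_ge_0 a); pose proof (Cmod_ge_0 b).
  assert (0 <= (1 - Cmod a ^ 2) * (1 - Cmod b ^ 2)) by (apply Rmult_le_pos; nra).
  lra.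
Qed.

Lemma one_minus_conj_mult_neq_0 (a b : C) :
  Cmod a < 1 -> Cmod b < 1 -> (1 - Cconj a * b)%C <> 0%C.
Proof.
  intros Ha Hb E; pose proof (Cmod_one_minus_conj_mult a b) as H.
  rewrite E, Cmod_0 in H.
  pose proof (Cmod_ge_0 a); pose proof (Cmod_ge_0 b).
  assert (0 < (1 - Cmod a ^ 2) * (1 - Cmod b ^ 2)) by (apply Rmult_lt_0_compat; nra).
  pose proof (pow2_ge_0 (Cmod (a - b))); lra.
Qed.

(* The maximum principle applied to the quotient of the two Blaschke factors,
   [((f y - f z) / (1 - conj (f z) * f y)) / ((y - z) / (1 - conj z * y))]. *)
Lemma schwarz_pick (f : C -> C) (z w : C) :
  holomorphic_on unit_disk f ->
  (forall y, unit_disk y -> unit_disk (f y)) ->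
  unit_disk z -> unit_disk w ->
  Cmod (f z - f w) * Cmod (1 - Cconj z * w) <=
  Cmod (z - w) * Cmod (1 - Cconj (f z) * f w).
Proof.
  unfold holomorphic_on, unit_disk; intros Hf Hmap Hz Hw.
  assert (Df : forall y, Cmod y < 1 -> cdiff f y).
  { intros y Hy; destruct (ex_derive_slope f y (Hf y Hy)) as [q [Hq E]].
    exists q; split; [exact Hq | apply locally_2d_forall; intros; apply E]. }
  destruct (ex_derive_slope f z (Hf z Hz)) as [q [Hq Eq]].
  assert (Dq : forall y, Cmod y < 1 -> y <> z -> cdiff q y).
  { intros y Hy N.
    assert (Dyz : cdiff (fun x => x + - z)%C y)
      by (apply cdiff_plus; [apply cdiff_id | apply cdiff_const]).
    assert (Nyz : (y + - z)%C <> 0%C) by (apply Cminus_neq_0, N).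
    (* Near [y] the point [z] is avoided, and there [q] is the difference quotient. *)
    apply cdiff_ext_loc with (fun x => (f x + - f z) * / (x + - z))%C.
    - destruct (ccont_neq_0 _ y (cdiff_ccont _ _ Dyz) Nyz) as [d Hd].
      exists d; intros u v Hu Hv; specialize (Hd u v Hu Hv); revert Hd.
      generalize ((u, v) : C); intros x Hx; rewrite (Eq x); field; exact Hx.
    - apply cdiff_mult; [|apply cdiff_inv; assumption].
      apply cdiff_plus; [apply Df, Hy | apply cdiff_const]. }
  assert (Cq : forall y, Cmod y < 1 -> ccont q y).
  { intros y Hy; destruct (excluded_middle_informative (y = z)) as [->|N];
      [exact Hq | apply cdiff_ccont, Dq; assumption]. }
  (* [q * B] is the quotient of the Blaschke factors with the singularity at [z] already removed by
     [q]. *)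
  pose (B := fun y => ((1 + - Cconj z * y) * / (1 + - Cconj (f z) * f y))%C).
  assert (HN : forall y, Cmod y < 1 -> (1 + - Cconj (f z) * f y)%C <> 0%C).
  { intros y Hy; replace (1 + - Cconj (f z) * f y)%C with (1 - Cconj (f z) * f y)%C by ring.
    apply one_minus_conj_mult_neq_0; auto. }
  assert (DB : forall y, Cmod y < 1 -> cdiff B y).
  { intros y Hy; apply cdiff_mult.
    - apply cdiff_plus; [apply cdiff_const|].
      apply cdiff_mult; [apply cdiff_const | apply cdiff_id].
    - apply (cdiff_inv (fun y => 1 + - Cconj (f z) * f y)%C); [|apply HN, Hy].
      apply cdiff_plus; [apply cdiff_const|].
      apply cdiff_mult; [apply cdiff_const | apply Df, Hy]. }
  pose (h := fun y => (q y * B y)%C).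
  assert (Hh : forall y, Cmod y < 1 ->
    Cmod (h y) * (Cmod (z - y) * Cmod (1 - Cconj (f z) * f y)) =
    Cmod (f z - f y) * Cmod (1 - Cconj z * y)).
  { intros y Hy; rewrite <- !Cmod_mult; f_equal; unfold h, B; rewrite (Eq y) at 3.
    field; apply HN, Hy. }
  (* Nothing is known of [f] on the unit circle, so the maximum principle is used on the disk of
     radius [1 - t], at the cost of [eps]. *)
  assert (Hh1 : forall eps, 0 < eps -> Cmod (h w) <= 1 + eps).
  { intros eps He.
    pose (k := (1 - Cmod z) / 2).
    assert (Hk : 0 < k) by (unfold k; lra).
    assert (Hek : 0 < eps * k ^ 2 / 2) 
      by (apply Rdiv_lt_0_compat; [apply Rmult_lt_0_compat; [exact He | apply pow_lt, Hk] | lra]).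
    (* In turn: [w] lies in the smaller disk; [|z - y| >= 2 * k - t >= k] on its boundary; the
       defect [(1 - |z|^2) * (1 - |y|^2)], at most [2 * t], is at most [eps * k ^ 2]. *)
    pose (t := Rmin (1 - Cmod w) (Rmin k (eps * k ^ 2 / 2))).
    assert (Ht : 0 < t /\ t <= 1 - Cmod w /\ t <= k /\ t <= eps * k ^ 2 / 2).
    { unfold t; pose proof (Rmin_l (1 - Cmod w) (Rmin k (eps * k ^ 2 / 2))).
      pose proof (Rmin_r (1 - Cmod w) (Rmin k (eps * k ^ 2 / 2))).
      pose proof (Rmin_l k (eps * k ^ 2 / 2)); pose proof (Rmin_r k (eps * k ^ 2 / 2)).
      split; [repeat apply Rmin_pos; lra | repeat split; lra]. }
    pose proof (Cmod_ge_0 z); pose proof (Cmod_ge_0 w).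
    apply (maximum_modulus h z (1 - t)); try lra.
    - intros y Hy; apply ccont_mult; [apply Cq; lra | apply cdiff_ccont, DB; lra].
    - intros y Hy N; apply cdiff_mult; [apply Dq; [lra | exact N] | apply DB; lra].
    - intros y Hy.
      assert (Hy1 : Cmod y < 1) by lra.
      specialize (Hh y Hy1).
      assert (Hzy : k <= Cmod (z - y)).
      { pose proof (Cmod_triangle (y - z) z) as T.
        replace (y - z + z)%C with y in T by ring.
        replace (z - y)%C with (- (y - z))%C by ring; rewrite Cmod_opp.
        unfold k in *; lra. }
      assert (Hfy : Cmod (f z - f y) <= Cmod (1 - Cconj (f z) * f y)).
      { apply Cmod_sub_le_one_minus_conj_mult; left; auto. }
      assert (HP : 0 < Cmod (1 - Cconj (f z) * f y)).
      { apply Cmod_gt_0, one_minus_conj_mult_neq_0; auto. }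
      assert (Hle : Cmod (h y) * Cmod (z - y) <= Cmod (1 - Cconj z * y)).
      { apply Rmult_le_reg_r with (Cmod (1 - Cconj (f z) * f y)); [exact HP|].
        rewrite Rmult_assoc, Hh, Rmult_comm.
        apply Rmult_le_compat_l; [apply Cmod_ge_0 | exact Hfy]. }
      pose proof (Cmod_one_minus_conj_mult z y) as E; rewrite Hy in E.
      apply Cmod_le_sqr; [lra|].
      pose proof (Cmod_ge_0 (h y)); pose proof (Cmod_ge_0 (1 - Cconj z * y)).
      set (H' := Cmod (h y)) in *; set (Z := Cmod (z - y)) in *.
      set (P := Cmod (1 - Cconj z * y)) in *; set (c := Cmod z) in *.
      assert (E1 : (H' * Z) ^ 2 <= P ^ 2) by (apply pow_incr; split; [nra | exact Hle]).
      assert (E2 : (1 - c ^ 2) * (1 - (1 - t) ^ 2) <= eps * k ^ 2).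
      { assert (1 - (1 - t) ^ 2 <= 2 * t) by nra.
        assert (0 <= 1 - c ^ 2 <= 1) by nra.
        assert (0 <= 1 - (1 - t) ^ 2) by nra.
        nra. }
      assert (E3 : eps * k ^ 2 <= eps * Z ^ 2)
        by (apply Rmult_le_compat_l; [lra | apply pow_incr; lra]).
      assert (HZ : 0 < Z ^ 2) by (apply pow_lt; lra).
      (* The chain is [(H' * Z) ^ 2 <= P ^ 2 <= (1 + eps) * Z ^ 2 <= (1 + eps) ^ 2 * Z ^ 2]. *)
      apply Rmult_le_reg_r with (Z ^ 2); [exact HZ|].
      rewrite <- Rpow_mult_distr.
      assert ((1 + eps) * Z ^ 2 <= (1 + eps) ^ 2 * Z ^ 2) by (apply Rmult_le_compat_r; nra).
      lra. }
  rewrite <- Hh by exact Hw.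
  assert (Hle : Cmod (h w) <= 1).
  { apply Rnot_lt_le; intros Hlt; specialize (Hh1 ((Cmod (h w) - 1) / 2)); lra. }
  rewrite <- (Rmult_1_l (Cmod (z - w) * _)) at 2.
  apply Rmult_le_compat_r; [apply Rmult_le_pos; apply Cmod_ge_0 | exact Hle].
Qed.

(** * Estimates in the unit disk *)

Lemma unit_circle_boundary (y : C) : Cmod y = 1 -> boundary unit_disk y.
Proof.
  intros Hy P HP; split.
  - destruct HP as [d Hd].
    pose (s := Rmin (1 / 2) (d / 2)).
    assert (Hs : 0 < s /\ s <= 1 / 2 /\ s < d).
    { pose proof (cond_pos d); unfold s, Rmin; destruct (Rle_dec (1 / 2) (d / 2)); lra. }
    exists (RtoC (1 - s) * y)%C; split.
    + apply Hd, C_NormedModule_mixin_compat1.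
      replace (minus (RtoC (1 - s) * y)%C y) with (RtoC (- s) * y)%C.
      * rewrite Cmod_mult, Cmod_R, Rabs_Ropp, Rabs_pos_eq, Hy by lra; lra.
      * transitivity (RtoC (1 - s) * y - y)%C; [|reflexivity].
        rewrite RtoC_minus, RtoC_opp; ring.
    + unfold unit_disk; rewrite Cmod_mult, Cmod_R, Rabs_pos_eq, Hy by lra; lra.
  - exists y; split; [exact (locally_singleton y P HP) | unfold unit_disk; lra].
Qed.

Lemma boundary_unit_disk_ge (y : C) : boundary unit_disk y -> 1 <= Cmod y.
Proof.
  intros H; apply Rnot_lt_le; intros Hy.
  destruct (H unit_disk) as [_ [x [Hx Hn]]]; [|now apply Hn].
  (* Balls of [C] are squares in the coordinates, whence the factor [sqrt 2]. *)
  assert (Hd : 0 < (1 - Cmod y) / sqrt 2)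
    by (apply Rdiv_lt_0_compat; [lra | apply Rlt_sqrt2_0]).
  exists (mkposreal _ Hd); intros x Hx; unfold unit_disk.
  apply (C_NormedModule_mixin_compat2 y x) in Hx; simpl in Hx.
  replace (sqrt 2 * ((1 - Cmod y) / sqrt 2)) with (1 - Cmod y) in Hx
    by (field; pose proof Rlt_sqrt2_0; lra).
  change (Cmod (x - y) < 1 - Cmod y) in Hx.
  replace x with (x - y + y)%C by ring.
  pose proof (Cmod_triangle (x - y) y); lra.
Qed.

(** The triangle inequality bounds the distance below, and the radial projection [z / |z|] attains
    it; for [z = 0] the point [1] takes its place. *)
Lemma dist_to_unit_circle (z : C) :
  unit_disk z -> dist_to z (boundary unit_disk) = 1 - Cmod z.
Proof.
  unfold unit_disk; intros Hz; unfold dist_to.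
  rewrite (is_glb_Rbar_unique _ (Finite (1 - Cmod z))); [reflexivity|]; split.
  - intros r [y [Hy ->]]; simpl.
    apply boundary_unit_disk_ge in Hy.
    pose proof (Cmod_triangle (y - z) z) as T; replace (y - z + z)%C with y in T by ring.
    replace (z - y)%C with (- (y - z))%C by ring; rewrite Cmod_opp; lra.
  - intros b Hb; apply Hb.
    destruct (excluded_middle_informative (z = 0%C)) as [->|N].
    + exists 1%C; split; [apply unit_circle_boundary, Cmod_1|].
      replace (0 - 1)%C with (- (1))%C by ring.
      rewrite Cmod_opp, Cmod_1, Cmod_0; ring.
    + pose proof (proj1 (Cmod_gt_0 z) N) as Hz0.
      exists (RtoC (/ Cmod z) * z)%C; split.
      * apply unit_circle_boundary.
        rewrite Cmod_mult, Cmod_R, Rabs_pos_eq by (left; apply Rinv_0_lt_compat, Hz0).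
        field; lra.
      * replace (z - RtoC (/ Cmod z) * z)%C with (RtoC (1 - / Cmod z) * z)%C
          by (rewrite RtoC_minus; ring).
        assert (1 < / Cmod z) by (rewrite <- Rinv_1; apply Rinv_lt_contravar; lra).
        rewrite Cmod_mult, Cmod_R, Rabs_left by lra.
        field; lra.
Qed.

(* With [x = |a - b|] and [K = |1 - conj a * b|] for [|a| = alpha], [|b| = beta]:
   a pseudohyperbolic distance [x / K] at most [t / N] bounds [x / (1 - alpha)]. *)
Lemma pseudohyperbolic_upper (alpha beta x K t N : R) :
  0 <= alpha < 1 -> Rabs (alpha - x) <= beta -> 0 <= x -> 0 <= K ->
  K ^ 2 = x ^ 2 + (1 - alpha ^ 2) * (1 - beta ^ 2) ->
  0 <= t < N -> x * N <= t * K ->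
  x * (N - t) <= 2 * t * (1 - alpha).
Proof.
  intros Ha Hb Hx HK EK Ht HxN.
  (* Equality holds in the extreme case [beta = |alpha - x|], as [x ^ 2 + (1 - alpha ^ 2) * (1 -
     (alpha - x) ^ 2)] is the square of the right-hand side. *)
  assert (HK1 : K <= 1 - alpha ^ 2 + alpha * x).
  { assert (0 <= 1 - alpha ^ 2) by nra.
    assert (0 <= alpha * x) by nra.
    apply Rsqr_incr_0; [|lra|lra]; rewrite !Rsqr_pow2, EK.
    assert (Hsq : (alpha - x) ^ 2 <= beta ^ 2).
    { rewrite <- (pow2_abs (alpha - x)); apply pow_incr; split; [apply Rabs_pos | exact Hb]. }
    assert (0 <= (1 - alpha ^ 2) * (beta ^ 2 - (alpha - x) ^ 2)) by (apply Rmult_le_pos; lra).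
    lra. }
  assert (H1 : x * (N - t * alpha) <= t * ((1 - alpha) * (1 + alpha))) by nra.
  (* The difference of the two sides is [(1 - alpha) * (N + t)]. *)
  assert (H2 : (1 + alpha) * (N - t) <= 2 * (N - t * alpha)) by nra.
  assert (H3 : 0 < N - t * alpha) by nra.
  apply Rmult_le_reg_r with (N - t * alpha); [exact H3|].
  apply Rle_trans with (t * (1 - alpha) * ((1 + alpha) * (N - t))).
  - replace (x * (N - t) * (N - t * alpha)) with (x * (N - t * alpha) * (N - t)) by ring.
    replace (t * (1 - alpha) * ((1 + alpha) * (N - t)))
      with (t * ((1 - alpha) * (1 + alpha)) * (N - t)) by ring.
    apply Rmult_le_compat_r; lra.
  - replace (2 * t * (1 - alpha) * (N - t * alpha))
      with (t * (1 - alpha) * (2 * (N - t * alpha))) by ring.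
    apply Rmult_le_compat_l; [nra | exact H2].
Qed.

(* [t + 2 * m ^ 2 / (t + 2 * m)] is the value of [N] for which
   [(1 + t / N) / (1 - t / N) = (1 + t / m) ^ 2]. *)
Lemma pseudohyperbolic_lower (alpha beta m t N : R) :
  0 <= alpha -> 0 <= beta -> 0 < m -> alpha <= 1 - m -> beta <= 1 - m ->
  0 <= t <= alpha + beta -> 0 <= N ->
  N ^ 2 = t ^ 2 + (1 - alpha ^ 2) * (1 - beta ^ 2) ->
  t + 2 * m ^ 2 / (t + 2 * m) <= N.
Proof.
  intros Ha Hb Hm Ham Hbm Ht HN EN.
  set (s := t + 2 * m).
  assert (Hs : 0 < s <= 2) by (unfold s; lra).
  set (v := 2 * m / s).
  assert (Hvs : v * s = 2 * m) by (unfold v; field; lra).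
  (* [m <= v] amounts to [s <= 2], which comes from [t <= alpha + beta <= 2 - 2 * m]. *)
  assert (Hv : m <= v <= 1).
  { assert (v <= 1) by (apply Rle_div_l; unfold s; lra). split; [nra | assumption]. }
  assert (Et : t = s - v * s) by (rewrite Hvs; unfold s; ring).
  replace (2 * m ^ 2 / s) with (m * v) by (unfold v; field; lra).
  apply Rsqr_incr_0; [|nra|exact HN]; rewrite !Rsqr_pow2, EN.
  assert (A1 : m * (2 - m) <= 1 - alpha ^ 2) by nra.
  assert (A2 : m * (2 - m) <= 1 - beta ^ 2) by nra.
  assert (A3 : (m * (2 - m)) * (m * (2 - m)) <= (1 - alpha ^ 2) * (1 - beta ^ 2))
    by (apply Rmult_le_compat; nra).
  (* The claimed lower bound thus exceeds [t] in square by [(m * (2 - v)) ^ 2], while [N] does so by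
     at least [(m * (2 - m)) ^ 2]; [m <= v] compares them. *)
  assert (A4 : (t + m * v) ^ 2 - t ^ 2 = (m * (2 - v)) * (m * (2 - v))).
  { replace ((t + m * v) ^ 2 - t ^ 2) with (2 * t * m * v + m ^ 2 * v ^ 2) by ring.
    rewrite Et at 1.
    replace (2 * (s - v * s) * m * v) with (2 * m * (v * s) * (1 - v)) by ring.
    rewrite Hvs; ring. }
  assert (A5 : (m * (2 - v)) * (m * (2 - v)) <= (m * (2 - m)) * (m * (2 - m)))
    by (apply Rmult_le_compat; nra).
  lra.
Qed.

Lemma distance_ratio_unit_disk (z w : C) :
  unit_disk z -> unit_disk w ->
  distance_ratio unit_disk z w =
  ln (1 + Cmod (z - w) / Rmin (1 - Cmod z) (1 - Cmod w)).
Proof.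
  intros Hz Hw; unfold distance_ratio; rewrite !dist_to_unit_circle by assumption.
  reflexivity.
Qed.

Lemma Cmod_sub_le (a b : C) : Cmod (a - b) <= Cmod a + Cmod b.
Proof.
  rewrite <- (Cmod_opp b); apply Cmod_triangle.
Qed.

(** Both orders are stated because either point may be the one nearer to the circle in
    [pseudohyperbolic_upper]. *)
Lemma Cmod_sub_dist (a b : C) :
  Rabs (Cmod a - Cmod (a - b)) <= Cmod b /\ Rabs (Cmod b - Cmod (a - b)) <= Cmod a.
Proof.
  pose proof (Cmod_sub_le a b).
  pose proof (Cmod_triangle (a - b) b) as T1; replace (a - b + b)%C with a in T1 by ring.
  pose proof (Cmod_sub_le a (a - b)) as T2; replace (a - (a - b))%C with b in T2 by ring.
  split; apply Rabs_le; lra.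
Qed.

Theorem theorem2 :
  forall f : C -> C,
    holomorphic_on unit_disk f ->
    (forall z : C, unit_disk z -> unit_disk (f z)) ->
    forall z w : C, unit_disk z -> unit_disk w ->
      distance_ratio unit_disk (f z) (f w) <= 2 * distance_ratio unit_disk z w.
Proof.
  intros f Hf Hmap z w Hz Hw.
  pose proof (schwarz_pick f z w Hf Hmap Hz Hw) as SP.
  pose proof (Hmap z Hz) as Ha; pose proof (Hmap w Hw) as Hb.
  rewrite !distance_ratio_unit_disk by assumption.
  revert SP Ha Hb; generalize (f z) (f w); intros a b SP Ha Hb.
  unfold unit_disk in *.
  pose proof (Cmod_one_minus_conj_mult z w) as EN.
  pose proof (Cmod_one_minus_conj_mult a b) as EK.
  destruct (Cmod_sub_dist a b) as [Tab Tba].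
  pose proof (Cmod_sub_le z w) as Tzw.
  pose proof (Cmod_ge_0 (a - b)); pose proof (Cmod_ge_0 (z - w)).
  pose proof (Cmod_ge_0 (1 - Cconj a * b)); pose proof (Cmod_ge_0 (1 - Cconj z * w)).
  pose proof (Cmod_ge_0 z); pose proof (Cmod_ge_0 w).
  pose proof (Cmod_ge_0 a); pose proof (Cmod_ge_0 b).
  set (x := Cmod (a - b)) in *; set (t := Cmod (z - w)) in *.
  set (K := Cmod (1 - Cconj a * b)) in *; set (N := Cmod (1 - Cconj z * w)) in *.
  set (m := Rmin (1 - Cmod z) (1 - Cmod w)).
  set (m' := Rmin (1 - Cmod a) (1 - Cmod b)).
  assert (Hm : 0 < m) by (apply Rmin_pos; lra).
  assert (Hm' : 0 < m') by (apply Rmin_pos; lra).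
  assert (Hm1 : m <= 1 - Cmod z) by apply Rmin_l.
  assert (Hm2 : m <= 1 - Cmod w) by apply Rmin_r.
  assert (HN : t + 2 * m ^ 2 / (t + 2 * m) <= N)
    by (apply (pseudohyperbolic_lower (Cmod z) (Cmod w)); lra).
  assert (Hgap : 0 < 2 * m ^ 2 / (t + 2 * m)) by (apply Rdiv_lt_0_compat; nra).
  (* [m'] belongs to the point of larger modulus, which takes the role of [alpha]. *)
  assert (Hx : x * (N - t) <= 2 * t * m').
  { unfold m', Rmin; destruct (Rle_dec (1 - Cmod a) (1 - Cmod b)).
    - apply (pseudohyperbolic_upper _ (Cmod b) x K); lra.
    - apply (pseudohyperbolic_upper _ (Cmod a) x K); lra. }
  (* As [N - t >= 2 * m ^ 2 / (t + 2 * m)], [Hx] gives [x / m' <= t * (t + 2 * m) / m ^ 2], which is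
     [(1 + t / m) ^ 2 - 1]. *)
  assert (Hfin : 1 + x / m' <= (1 + t / m) ^ 2).
  { assert (E : x * (2 * m ^ 2 / (t + 2 * m)) <= 2 * t * m').
    { eapply Rle_trans; [|exact Hx]; apply Rmult_le_compat_l; lra. }
    assert (x / m' <= t * (t + 2 * m) / m ^ 2).
    { apply Rle_div_l; [exact Hm'|].
      apply Rmult_le_reg_r with (2 * m ^ 2 / (t + 2 * m)); [exact Hgap|].
      replace (t * (t + 2 * m) / m ^ 2 * m' * (2 * m ^ 2 / (t + 2 * m)))
        with (2 * t * m') by (field; lra).
      exact E. }
    replace ((1 + t / m) ^ 2) with (1 + t * (t + 2 * m) / m ^ 2) by (field; lra).
    lra. }
  assert (0 <= t / m) by (apply Rdiv_le_0_compat; lra).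
  assert (0 <= x / m') by (apply Rdiv_le_0_compat; lra).
  replace (2 * ln (1 + t / m)) with (ln ((1 + t / m) ^ 2)).
  - apply ln_le; lra.
  - rewrite ln_pow by lra; simpl; ring.
Qed.
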